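(* Let $G$ be a finite simple graph. Then $\chi_\ell^\star(G)=2$ if and only if $G$ is a forest with at least one edge. Likewise, $\chi_c^\star(G)=2$ if and only if $G$ is a forest with at least one edge.
   Context: A correspondence-cover of a graph $G$ is a pair $(L,H)$ where $H$ is a graph and $L:V(G)\to 2^{V(H)}$ is such that: the sets $L(v)$, $v\in V(G)$, partition $V(H)$; for distinct $u,v$ with $uv\notin E(G)$ there are no edges of $H$ between $L(u)$ and $L(v)$; for $uv\in E(G)$ the edges of $H$ between $L(u)$ and $L(v)$ form a matching; and each $L(v)$ induces a clique in $H$. It is $k$-fold if $|L(v)|=k$ for all $v$. A $k$-list-assignment $L$ assigns to each vertex a set $L(v)\subseteq\mathbb{N}$ of size $k$; its associated list-cover has vertex set $\{x_v: v\in V(G), x\in L(v)\}$, with $\tilde L(v)=\{x_v:x\in L(v)\}$ a clique for each $v$, and $x_ux_v$ an edge for each edge $uv\in E(G)$ and each colour $x\in L(u)\cap L(v)$. The list packing number $\chi_\ell^\star(G)$ is the least $k$ such that for every $k$-list-assignment $L$ of $G$ the associated list-cover has chromatic number $k$ (equivalently, $G$ has $k$ proper $L$-colourings $c_1,\dots,c_k$ with $c_i(v)\in L(v)$ and $c_i(v)\neq c_j(v)$ for all $v$ and $i\ne j$). The correspondence packing number $\chi_c^\star(G)$ is the least $k$ such that every $k$-fold correspondence-cover $(L,H)$ of $G$ satisfies $\chi(H)=k$. *)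

(* Defs.v *)
From mathcomp Require Import all_boot finmap.

Set Implicit Arguments.
Unset Strict Implicit.
Unset Printing Implicit Defensive.

Record sgraph := SGraph {
  svertex :> finType;
  sedge : rel svertex;
  sedge_sym : symmetric sedge;
  sedge_irrefl : irreflexive sedge }.
Arguments sedge {s} : rename.

Section Chromatic.
Variable G : sgraph.

Definition colorable (k : nat) : bool :=
  [exists c : {ffun G -> 'I_k}, forall x, forall y, sedge x y ==> (c x != c y)].

Lemma colorable_exists : exists k, colorable k.
Proof.
exists #|G|; apply/existsP; exists [ffun x => enum_rank x].
apply/forallP=> x; apply/forallP=> y; apply/implyP=> exy; rewrite !ffunE.
by apply: contraTneq exy => /enum_rank_inj ->; rewrite sedge_irrefl.
Qed.

Definition chromatic_number : nat := ex_minn colorable_exists.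

(* The empty sequence and [:: u; v] for an edge uv also satisfy [ucycle];
   only sequences of at least three vertices are cycles of the graph. *)
Definition is_forest : Prop :=
  ~ exists c : seq G, 2 < size c /\ ucycle sedge c.

Definition has_edge : Prop := exists u v : G, sedge u v.

End Chromatic.

Record correspondence_cover (G H : sgraph) (L : G -> {set H}) : Prop := {
  ccover_total : forall x : H, exists v : G, x \in L v;
  ccover_disjoint : forall u v : G, u != v -> [disjoint L u & L v];
  ccover_nonadjacent : forall u v : G, u != v -> ~~ sedge u v ->
    forall x y : H, x \in L u -> y \in L v -> ~~ sedge x y;
  ccover_matching : forall u v : G, sedge u v ->
    forall x x' y y' : H, x \in L u -> x' \in L u -> y \in L v -> y' \in L v ->
    sedge x y -> sedge x' y' -> (x = x' <-> y = y');
  ccover_clique : forall (v : G) (x y : H),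
    x \in L v -> y \in L v -> x != y -> sedge x y }.

Section ListCover.
Variables (G : sgraph) (L : G -> {fset nat}).

(* The vertex [Tagged _ x] over [v : G], with [x : L v], is x_v. *)
Definition list_cover_vertex : finType := {v : G & L v}.

Definition list_cover_edge (p q : list_cover_vertex) : bool :=
  (tag p == tag q) && (p != q)
  || sedge (tag p) (tag q) && (val (tagged p) == val (tagged q)).

Lemma list_cover_edge_sym : symmetric list_cover_edge.
Proof.
move=> p q; rewrite /list_cover_edge (eq_sym (tag p)) (eq_sym p) sedge_sym.
by rewrite (eq_sym (val (tagged p))).
Qed.

Lemma list_cover_edge_irrefl : irreflexive list_cover_edge.
Proof. by move=> p; rewrite /list_cover_edge !eqxx sedge_irrefl. Qed.

Definition list_cover : sgraph :=
  SGraph list_cover_edge_sym list_cover_edge_irrefl.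

End ListCover.

Definition list_packable (G : sgraph) (k : nat) : Prop :=
  forall L : G -> {fset nat},
    (forall v, #|` L v| = k) -> chromatic_number (list_cover L) = k.

Definition correspondence_packable (G : sgraph) (k : nat) : Prop :=
  forall (H : sgraph) (L : G -> {set H}),
    correspondence_cover L -> (forall v, #|L v| = k) -> chromatic_number H = k.

(* "Least k" ranges over positive k: at k = 0 the only cover is the empty
   graph, of chromatic number 0, so 0 would always qualify. *)
Definition least_positive (P : nat -> Prop) (k : nat) : Prop :=
  [/\ 0 < k, P k & forall j, 0 < j -> P j -> k <= j].

Definition is_list_packing_number (G : sgraph) (k : nat) : Prop :=
  least_positive (list_packable G) k.

Definition is_correspondence_packing_number (G : sgraph) (k : nat) : Prop :=
  least_positive (correspondence_packable G) k.

(* Main.v *)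
(* A vertex of a forest having at most one neighbour left can be coloured last:
   its two cover vertices then meet at most one matching, so a proper 2-colouring
   of the rest of a 2-fold cover extends to it, and every 2-fold cover of a forest
   is 2-colourable.  Conversely, around a cycle the lists {1,2}, except for two
   consecutive lists {1,3}, {2,3} when the length is even, give a list-cover
   containing an odd cycle. *)
Require Import Defs.
From mathcomp Require Import all_boot finmap.

Set Implicit Arguments.
Unset Strict Implicit.
Unset Printing Implicit Defensive.

(** * Bounds on the chromatic number *)

Lemma chromatic_number_colorable (G : sgraph) : colorable G (chromatic_number G).
Proof. by rewrite /chromatic_number; case: ex_minnP. Qed.

Lemma chromatic_number_le (G : sgraph) k :
  colorable G k -> chromatic_number G <= k.
Proof. by rewrite /chromatic_number; case: ex_minnP => m _ + /[dup] H; apply. Qed.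

Lemma colorableP (G : sgraph) k :
  reflect (exists c : G -> 'I_k, forall x y, sedge x y -> c x != c y)
          (colorable G k).
Proof.
apply: (iffP existsP) => -[c Hc].
  by exists c => x y; move/forallP/(_ x)/forallP/(_ y)/implyP: Hc; apply.
exists (finfun c); apply/forallP=> x; apply/forallP=> y; apply/implyP=> /Hc.
by rewrite !ffunE.
Qed.

Lemma chromatic_number_gt0 (G : sgraph) (x : G) : 0 < chromatic_number G.
Proof.
have /colorableP[c _] := chromatic_number_colorable G.
exact: leq_ltn_trans (ltn_ord (c x)).
Qed.

Lemma chromatic_number_gt1 (G : sgraph) (x y : G) :
  sedge x y -> 1 < chromatic_number G.
Proof.
have /colorableP[c Hc] := chromatic_number_colorable G.
move=> /Hc; move: (c x) (c y) => {Hc c}.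
by case: (chromatic_number G) => [[]|[i j|]] //; rewrite !ord1 eqxx.
Qed.

Lemma colorable2P (G : sgraph) :
  reflect (exists c : G -> bool, forall x y, sedge x y -> c x != c y)
          (colorable G 2).
Proof.
apply: (iffP (colorableP G 2)) => -[c Hc].
  exists (fun x => c x == ord0) => x y /Hc.
  by case: (c x) (c y) => [[|[|//]] ?] [[|[|//]] ?].
exists (fun x => if c x then ord0 else ord_max) => x y /Hc.
by case: (c x); case: (c y).
Qed.

(** * List-covers as correspondence-covers *)

Lemma list_cover_correspondence (G : sgraph) (L : G -> {fset nat}) :
  correspondence_cover (H := list_cover L)
    (fun v => [set p : list_cover_vertex L | tag p == v]).
Proof.
split.
- by move=> x; exists (tag x); rewrite inE.
- move=> u v uv; rewrite -setI_eq0; apply/eqP/setP=> x; rewrite !inE.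
  by apply/negP=> /andP[/eqP -> /eqP E]; rewrite E eqxx in uv.
- move=> u v uv nuv x y; rewrite !inE => /eqP xu /eqP yv.
  by subst u v; rewrite /= /list_cover_edge (negPf uv) (negPf nuv).
- move=> u v uv [a x] [a' x'] [b y] [b' y'].
  rewrite !inE /= => /eqP ? /eqP ? /eqP ? /eqP ?; subst.
  have E : (u == v) = false.
    by apply: contraTF uv => /eqP ->; rewrite sedge_irrefl.
  rewrite /list_cover_edge /= E uv /= => /eqP xy /eqP xy'.
  split=> /eqP; rewrite eq_Tagged => /eqP /= H; congr existT; apply: val_inj.
    by apply: etrans (esym xy) (etrans _ xy'); rewrite H.
  by apply: etrans xy (etrans _ (esym xy')); rewrite H.
- move=> v x y; rewrite !inE => /eqP xv /eqP yv xy.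
  by rewrite /= /list_cover_edge xy {1}xv {1}yv eqxx.
Qed.

Lemma card_list_cover_fiber (G : sgraph) (L : G -> {fset nat}) (v : G) :
  #|[set p : list_cover_vertex L | tag p == v]| = #|` L v|.
Proof.
have -> : [set p : list_cover_vertex L | tag p == v]
        = [set (Tagged (fun u => L u) x : list_cover_vertex L) | x : L v].
  apply/setP=> -[u x]; rewrite !inE /=; apply/eqP/imsetP => [E|[y _]].
  - by subst u; exists x.
  - by move/(congr1 tag).
rewrite card_imset ?cardfE // => x y /eqP.
by rewrite eq_Tagged => /eqP.
Qed.

(** Thanks to this transfer, sufficiency has to be shown only for correspondence-covers and
    necessity only for list-covers. *)
Lemma correspondence_list_packable (G : sgraph) k :
  correspondence_packable G k -> list_packable G k.
Proof.
move=> H L HL; apply: (H _ _ (list_cover_correspondence L)) => v.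
by rewrite card_list_cover_fiber.
Qed.

(** * Two-colouring the 2-fold covers of a forest *)

Section Forest.
Variable G : sgraph.
Hypothesis forestG : is_forest G.

(** If every vertex of [S] had two neighbours in [S], a path starting in [S] could always be
    prolonged at its front: a new neighbour lying on the path would close a cycle. Arbitrarily long
    paths are impossible in a finite graph. *)
Lemma forest_leaf (S : {set G}) (x0 : G) : x0 \in S ->
  exists2 v, v \in S & #|[set w in S | sedge v w]| <= 1.
Proof.
move=> x0S; apply/exists_inP; apply: contraT => /exists_inPn deg2; exfalso.
have long n : exists x p,
    [/\ x \in S, path sedge x p, uniq (x :: p) & size p = n].
  elim: n => [|n [x [p [xS pp up sp]]]]; first by exists x0, [::].
  (* [head x p] is the second vertex of the path. For empty [p] it is [x], which is not its own
     neighbour. *)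
  have : 0 < #|[set w in S | sedge x w] :\ head x p|.
    have := deg2 x xS; rewrite -ltnNge (cardsD1 (head x p)).
    by case: (_ \in _) => //= /ltnW.
  case/card_gt0P => z; rewrite !inE => /and3P[zh zS xz].
  have zx : z != x by apply: contraTneq xz => ->; rewrite sedge_irrefl.
  have [zp|zp] := boolP (z \in p); last first.
    exists z, (x :: p); split=> //=; last by rewrite sp.
      by rewrite sedge_sym xz.
    by rewrite inE negb_or zx zp.
  case/splitPr: zp zh pp up {sp} => p1 p2 zh pp up; case: forestG.
  (* The path from [x] to [z], closed by the edge [xz]; since [z] is not the second vertex, [p1] is
     nonempty and the cycle has at least three vertices. *)
  exists (x :: rcons p1 z); split.
    by case: p1 zh {pp up} => [|? ?] /=; rewrite ?eqxx // size_rcons.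
  rewrite -cat_rcons -cat_cons in pp up.
  move: pp up; rewrite cat_path cat_uniq => /andP[pp _] /andP[up _].
  by rewrite /ucycle up /cycle rcons_path pp last_rcons sedge_sym xz.
have [x [p [_ _ up sp]]] := long #|G|.
by have := max_card (mem (x :: p)); rewrite (card_uniqP up) /= sp ltnn.
Qed.

Variables (H : sgraph) (L : G -> {set H}).
Hypothesis cover : correspondence_cover L.
Hypothesis fold2 : forall v, #|L v| = 2.

(** Induction on the size of [S], removing a leaf [v]. The colouring is defined on all of [H] but
    constrained only over [S], so the cover need not be restricted to a subgraph. *)
Lemma forest_cover_coloring (S : {set G}) :
  exists f : H -> bool, forall u v x y, u \in S -> v \in S ->
    x \in L u -> y \in L v -> sedge x y -> f x != f y.
Proof.
move En: #|S| => n; elim: n S En => [|n IH] S En.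
  by exists xpredT => u v x y; rewrite (cards0_eq En) inE.
have /card_gt0P[x0 /forest_leaf[v vS leaf]] : 0 < #|S| by rewrite En.
have [|f Hf] := IH (S :\ v); first by move: En; rewrite (cardsD1 v) vS => -[].
have /cards2P[a [b [ab Lv]]] := introT eqP (fold2 v).
(* The two proper colourings of the clique [L v] are [c (+) (x == a)] for the two values of [c];
   only this bit has to be chosen. *)
have [c Hc] : exists c : bool, forall u x y, u \in S :\ v ->
    x \in L v -> y \in L u -> sedge x y -> (c (+) (x == a)) != f y.
  have [/exists_inP[u uN]|none] :=
    boolP [exists u in [set w in S | sedge v w],
             [exists x in L v, exists y in L u, sedge x y]]; last first.
    exists true => u x y; rewrite !inE => /andP[uv uS] xL yL xy.
    case/negP: none; apply/exists_inP; exists u.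
      rewrite inE uS; apply: contraT => nvu.
      by have := ccover_nonadjacent cover _ nvu xL yL;
        rewrite eq_sym uv xy => /(_ isT).
    by apply/exists_inP; exists x => //; apply/exists_inP; exists y.
  case/exists_inP => x xL /exists_inP[y yL xy].
  (* This bit gives [x] the colour opposite to [y]. Any other edge leaving [L v] over [S] also ends
     in [L u]; by the matching condition it is disjoint from [xy], so both of its ends have flipped
     colours and it is proper too. *)
  exists (~~ f y (+) (x == a)) => u' x' y'; rewrite !inE => /andP[u'v u'S] xL' yL' xy'.
  have u'N : u' \in [set w in S | sedge v w].
    rewrite inE u'S; apply: contraT => nvu.
    by have := ccover_nonadjacent cover _ nvu xL' yL';
      rewrite eq_sym u'v xy' => /(_ isT).
  have E := card_le1_eqP leaf _ _ u'N uN; subst u'.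
  move: u'N; rewrite inE => /andP[_ vu].
  have M := ccover_matching cover vu xL xL' yL yL' xy xy'.
  have [E|nE] := eqVneq x x'.
    by have <- := M.1 E; rewrite -E; case: (f y); case: (x == a).
  have nEy : y != y' by apply: contraNneq nE => /(M.2)/eqP.
  have fyy : f y != f y'.
    have uSv : u \in S :\ v by rewrite !inE u'v.
    exact: (Hf _ _ _ _ uSv uSv yL yL' (ccover_clique cover yL yL' nEy)).
  have -> : (x' == a) = ~~ (x == a).
    move: xL xL' nE; rewrite Lv !inE.
    by do 2!case/orP => /eqP->; rewrite ?eqxx //= ?(eq_sym b) ?(negPf ab) ?eqxx.
  by case: (f y) (f y') fyy => [] []; case: (x == a).
have Sv u x : u \in S -> x \in L u -> x \notin L v -> u \in S :\ v.
  by move=> uS xu; apply: contraR; rewrite !inE uS andbT negbK => /eqP <-.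
exists (fun x => if x \in L v then c (+) (x == a) else f x).
move=> u w x y uS wS xu yw xy.
have [xv|xv] := boolP (x \in L v); have [yv|yv] := boolP (y \in L v).
- have : x != y by apply: contraTneq xy => ->; rewrite sedge_irrefl.
  move: xv yv; rewrite Lv !inE.
  by do 2!case/orP => /eqP->; rewrite ?eqxx // ?(eq_sym b) (negPf ab) => _; case: (c).
- exact: (Hc _ _ _ (Sv _ _ wS yw yv) xv yw xy).
- rewrite eq_sym; apply: (Hc _ _ _ (Sv _ _ uS xu xv) yv xu).
  by rewrite sedge_sym.
- exact: (Hf _ _ _ _ (Sv _ _ uS xu xv) (Sv _ _ wS yw yv) xu yw xy).
Qed.

End Forest.

(** The vertex [v] excludes the empty graph, whose cover has chromatic number 0; the edge inside
    [L v] gives the lower bound. *)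
Lemma forest_correspondence_packable2 (G : sgraph) (v : G) :
  is_forest G -> correspondence_packable G 2.
Proof.
move=> forestG H L cover fold2; apply/eqP; rewrite eqn_leq; apply/andP; split.
  have [f Hf] := forest_cover_coloring forestG cover fold2 [set: G].
  apply: chromatic_number_le; apply/colorable2P; exists f => x y.
  have [u xu] := ccover_total cover x; have [w yw] := ccover_total cover y.
  exact: Hf xu yw.
have /cards2P[a [b [ab Lv]]] := introT eqP (fold2 v).
apply: (@chromatic_number_gt1 _ a b).
by apply: (ccover_clique cover (v := v)); rewrite // Lv !inE eqxx ?orbT.
Qed.

(** * Packing with one colour, and the empty graph *)

Lemma edge_not_list_packable1 (G : sgraph) : has_edge G -> ~ list_packable G 1.
Proof.
(* With all lists equal to {0}, the list-cover is a copy of [G]. *)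
move=> [u [v uv]] /(_ (fun _ => [fset 0]%fset)) H.
have h0 : 0 \in [fset 0]%fset by rewrite inE.
pose z (w : G) : list_cover (fun _ : G => [fset 0]%fset) :=
  existT (fun _ => [fset 0]%fset : Type) w (FSetSub h0).
have : sedge (z u) (z v) by rewrite /= /list_cover_edge /= uv eqxx orbT.
by move/chromatic_number_gt1; rewrite H // => w; rewrite cardfs1.
Qed.

Lemma edgeless_correspondence_packable1 (G : sgraph) (v : G) :
  ~ has_edge G -> correspondence_packable G 1.
Proof.
move=> noE H L cover fold1; apply/eqP; rewrite eqn_leq; apply/andP; split.
  apply/chromatic_number_le/colorableP; exists (fun _ => ord0) => x y xy; exfalso.
  have [u xu] := ccover_total cover x; have [w yw] := ccover_total cover y.
  have [E|nE] := eqVneq u w.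
    subst w; have /cards1P[a La] := introT eqP (fold1 u).
    move: xu yw xy; rewrite La !inE => /eqP-> /eqP->.
    by rewrite sedge_irrefl.
  have [uw|nuw] := boolP (sedge u w); first by apply: noE; exists u, w.
  by have := ccover_nonadjacent cover nE nuw xu yw; rewrite xy.
have /card_gt0P[x _] : 0 < #|L v| by rewrite fold1.
exact: chromatic_number_gt0 x.
Qed.

(** The list-cover of the empty graph is empty and thus colourable with 0 colours. *)
Lemma list_packable2_inhabited (G : sgraph) : list_packable G 2 -> exists v : G, true.
Proof.
move=> P2; have [v _|G0] := pickP (xpredT : pred G); first by exists v.
have H : chromatic_number (list_cover (fun _ : G => fset0)) = 2.
  by apply: P2 => v; have := G0 v.
suff : chromatic_number (list_cover (fun _ : G => fset0)) <= 0 by rewrite H.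
apply/chromatic_number_le/colorableP.
have F (p : list_cover (fun _ : G => fset0)) : False by have := G0 (tag p).
by exists (fun p => match F p with end) => p; case: (F p).
Qed.

(** * Cycles obstruct list packing with two colours *)

Lemma colorable2_list_cover (G : sgraph) (L : G -> {fset nat}) :
  colorable (list_cover L) 2 -> exists g : G -> nat -> bool,
    (forall v x y, x != y -> x \in L v -> y \in L v -> g v x = ~~ g v y) /\
    (forall u v x, sedge u v -> x \in L u -> x \in L v -> g v x = ~~ g u x).
Proof.
case/colorable2P => f Hf.
(* [g v x] is the colour of the cover vertex x_v, with default [true] when [x] is not in [L v]. *)
pose g v x := if insub x is Some y then f (Tagged (fun u => L u) (y : L v)) else true.
have bool_neq (a b : bool) : b != a -> a = ~~ b by case: a b => [] [].
exists g; split=> [v x y xy xv yv|u v x uv xu xv]; rewrite /g !insubT;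
  apply/bool_neq/Hf; rewrite /= /list_cover_edge /=.
  by rewrite eqxx eq_Tagged /= -val_eqE /= eq_sym xy.
by rewrite uv eqxx orbT.
Qed.

Lemma list_packable2_forest (G : sgraph) : list_packable G 2 -> is_forest G.
Proof.
move=> P2 [[|v0 c] [// c3 /andP[cyc uc]]].
set n := size (v0 :: c) in c3.
pose l i : {fset nat} :=
  if odd n then [fset 1; 2]%fset
  else if i == 1 then [fset 1; 3]%fset
  else if i == 2 then [fset 2; 3]%fset else [fset 1; 2]%fset.
(* A vertex off the cycle has index [n] and receives the two-element list [l n]. *)
pose L (v : G) := l (index v (v0 :: c)).
have cardL v : #|` L v| = 2.
  by rewrite /L /l; do ![case: ifP => _]; rewrite cardfs2.
have := chromatic_number_colorable (list_cover L); rewrite (P2 _ cardL).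
case/colorable2_list_cover => g [gfib gedge].
pose v i := nth v0 (v0 :: c) i.
have Lv i : i < n -> L (v i) = l i by move=> ?; rewrite /L index_uniq.
move: cyc; rewrite /cycle rcons_path => /andP[/(pathP v0) pc closing].
have step i x : i.+1 < n -> x \in l i -> x \in l i.+1 ->
    g (v i.+1) x = ~~ g (v i) x.
  by move=> ilt xi xi'; apply: gedge; rewrite ?Lv //; [exact: pc | exact: ltnW].
have swap i x y : i < n -> x != y -> x \in l i -> y \in l i ->
    g (v i) x = ~~ g (v i) y.
  by move=> ilt xy xi yi; apply: gfib; rewrite ?Lv.
have vlast : last v0 c = v n.-1 by rewrite (last_nth v0).
have wrap : g (v 0) 1 = ~~ g (v n.-1) 1.
  (* The last list contains 1: the only even length that could place it at an exceptional index is
     2, which [c3] excludes. *)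
  have n0 : n.-1 != 1 /\ n.-1 != 2 \/ odd n.
    by move: c3; case: (n) => [|[|[|[|m]]]] //; [right | left].
  have l1 : 1 \in l n.-1.
    rewrite /l; case: ifP n0 => [_ _|_ [[/negPf-> /negPf->]|//]];
    by rewrite !inE.
  apply: gedge; rewrite ?Lv ?ltnSn //; first by rewrite -vlast.
  by rewrite /l; case: ifP; rewrite !inE.
(* It remains to find a walk of even length in the list-cover from colour 1 at [v 0] to colour 1 at
   [v n.-1]; the closing edge then completes an odd closed walk. *)
suff back : g (v n.-1) 1 = g (v 0) 1 by move: wrap; rewrite back; case: (g _ _).
have [on|en] := boolP (odd n).
  have alt i : i < n -> g (v i) 1 = odd i (+) g (v 0) 1.
    elim: i => [//|i IH ilt].
    by rewrite step ?IH ?(ltnW ilt) ?addNb // /l on !inE.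
  by rewrite alt ?ltnSn //; move: on; rewrite /n /= => /negPf ->.
have n4 : 3 < n by move: c3 en; case: (n) => [|[|[|[|m]]]].
have alt i : i.+3 < n -> g (v i.+3) 1 = odd i (+) g (v 0) 1.
  (* Six flips lead from [v 0] to [v 3]: colour 1 at [v 0] and [v 1], colour 3 at [v 1] and [v 2],
     colour 2 at [v 2] and [v 3], then colour 1 at [v 3]. The remaining [n - 4] steps keep colour
     1. *)
  elim: i => [_|i IH ilt].
    rewrite (swap 3 1 2) // ?(step 2) ?(swap 2 2 3) // ?(step 1) ?(swap 1 3 1) //
      ?(step 0) ?negbK //; do ?[exact: ltn_trans n4];
    by rewrite /l (negPf en) !inE.
  by rewrite step ?IH ?(ltnW ilt) ?addNb // /l (negPf en) !inE.
have E : n.-1 = (n - 4).+3 by case: (n) n4 => [|[|[|[|m]]]] //; rewrite !subSS subn0.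
have lt_last : n.-1 < n by [].
by move: lt_last; rewrite E => /alt ->; rewrite oddB // (negPf en).
Qed.

Theorem theorem1 (G : sgraph) :
  (is_list_packing_number G 2 <-> is_forest G /\ has_edge G) /\
  (is_correspondence_packing_number G 2 <-> is_forest G /\ has_edge G).
Proof.
(* A nonempty edgeless graph is already packable at 1. Failure for correspondence-covers follows
   from failure for list-covers, so this one claim serves both equivalences. *)
have edge_of : list_packable G 2 ->
    ~ correspondence_packable G 1 -> has_edge G.
  move=> /list_packable2_inhabited[v _] nP1.
  have [/existsP[x /existsP[y xy]]|nE] :=
    boolP [exists x : G, exists y, sedge x y]; first by exists x, y.
  case: nP1; apply: edgeless_correspondence_packable1 v _ => -[x [y xy]].
  by case/negP: nE; apply/existsP; exists x; apply/existsP; exists y.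
have packable2 : is_forest G /\ has_edge G -> correspondence_packable G 2.
  by move=> [F [v _]]; apply: forest_correspondence_packable2 v F.
split; split.
- move=> [_ P2 least]; split; first exact: list_packable2_forest.
  by apply: edge_of => // /correspondence_list_packable/least => /(_ isT).
- move=> FE; split=> // [|[|[|j]] // _ P1].
    exact/correspondence_list_packable/packable2.
  by case: (edge_not_list_packable1 FE.2).
- move=> [_ /[dup] C2 /correspondence_list_packable P2 least].
  split; first exact: list_packable2_forest.
  by apply: edge_of => // /least => /(_ isT).
- move=> FE; split=> // [|[|[|j]] // _ P1]; first exact: packable2.
  by case: (edge_not_list_packable1 FE.2); apply: correspondence_list_packable.
Qed.
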